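(* Let $V(t,x)$ be a real-valued $C^2$ function globally defined on $\mathbb{R}\times\mathbb{R}^n$. For any two points $x_0,x_1\in\mathbb{R}^n$, there exist a constant $c\in\mathbb{R}$ and a $C^2$ function $\tau\colon\mathbb{R}\to\mathbb{R}$, both depending on $x_0,x_1$, such that the second-order ODE $$\ddot{x}(t)=-2\Big(c+\int_0^t\big(\nabla_{x}\widetilde{V}\cdot\dot{x}\big)\,dt\Big)\nabla_{x}\widetilde{V},\qquad \widetilde{V}(t,x)=V(\tau(t),x),$$ has a complete solution $x(t)$ (i.e., defined for all $t\in\mathbb{R}$) passing through $x_0$ and $x_1$, which satisfies $$\frac12|\dot{x}(t)|^2+\frac14\dot{\tau}(t)^2=\text{const.}$$ If $V_t=0$ (i.e., $V=V(x)$ is independent of $t$), then the ODE $\ddot{x}(t)=-2\big(c+\int_0^t(\nabla_{x}\widetilde{V}\cdot\dot{x})\,dt\big)\nabla_{x}\widetilde{V}$ reduces to the Hamiltonian system $$\ddot{x}=-\nabla_{x}(V+\bar{c})^2,\qquad \bar{c}=c-V(x_0),$$ and the constant of the motion $\frac12|\dot{x}(t)|^2+\frac14\dot{\tau}(t)^2=\text{const.}$ reduces to the conservation of energy equation for the potential $(V+\bar{c})^2$, namely $\frac12|\dot{x}(t)|^2+\big(V(x(t))+\bar{c}\big)^2=\text{const.}$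
   Context: $\nabla_x$ denotes the gradient with respect to $x\in\mathbb{R}^n$ only, $\cdot$ the Euclidean inner product, and $|\cdot|$ the Euclidean norm; in the integral and in the ODE, $\nabla_x\widetilde V$ is evaluated along the solution, at $(t,x(t))$. *)

(* Defs.v *)
From HB Require Import structures.
From mathcomp Require Import all_boot all_order all_algebra.
From mathcomp Require Import all_classical all_reals all_analysis.

Set Implicit Arguments.
Unset Strict Implicit.
Unset Printing Implicit Defensive.

Import Order.TTheory GRing.Theory Num.Theory.
Import numFieldNormedType.Exports.

Local Open Scope classical_set_scope.
Local Open Scope ring_scope.

(* f is of class C^k; for a finite-dimensional U (the only case used) this is
   the classical notion: all iterated directional derivatives up to order k
   exist and are continuous. *)
Fixpoint classC (R : realType) (U W : normedModType R) (k : nat)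
    (f : U -> W) : Prop :=
  match k with
  | 0 => continuous f
  | k'.+1 => (forall p : U, differentiable f p) /\
             (forall v : U, classC k' ('D_v f))
  end.

Definition dotv (R : realType) (n : nat) (u v : 'rV[R]_n) : R :=
  \sum_(i < n) u ord0 i * v ord0 i.

(* The library norm on 'rV[R]_n is the sup norm, hence this one. *)
Definition enorm (R : realType) (n : nat) (u : 'rV[R]_n) : R :=
  Num.sqrt (dotv u u).

Definition grad (R : realType) (n : nat) (f : 'rV[R]_n -> R) (x : 'rV[R]_n) :
    'rV[R]_n :=
  \row_(i < n) 'D_(delta_mx ord0 i) f x.

(* Integral from a to b with the sign convention for b < a. *)
Definition oriented_int (R : realType) (a b : R) (f : R -> R) : R :=
  if a <= b then \int[lebesgue_measure]_(s in `[a, b]) f s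
  else - \int[lebesgue_measure]_(s in `[b, a]) f s.

Definition reparam (R : realType) (n : nat) (V : R * 'rV[R]_n -> R)
    (tau : R -> R) : R -> 'rV[R]_n -> R :=
  fun t y => V (tau t, y).

(* grad (U t) differentiates in the space variable only, with t frozen. *)
Definition solves_ode (R : realType) (n : nat) (U : R -> 'rV[R]_n -> R) (c : R)
    (x : R -> 'rV[R]_n) : Prop :=
  forall t : R,
    derive1n 2 x t =
      (- 2 * (c + oriented_int 0 t
                    (fun s => dotv (grad (U s) (x s)) (derive1 x s))))
      *: grad (U t) (x t).

Definition solves_hamiltonian (R : realType) (n : nat) (P : 'rV[R]_n -> R)
    (x : R -> 'rV[R]_n) : Prop :=
  forall t : R, derive1n 2 x t = - grad P (x t).

(* Main.v *)
Require Import Defs.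
From HB Require Import structures.
From mathcomp Require Import all_boot all_order all_algebra.
From mathcomp Require Import all_classical all_reals all_analysis.
From mathcomp Require Import ring lra.

Set Implicit Arguments.
Unset Strict Implicit.
Unset Printing Implicit Defensive.

Import Order.TTheory GRing.Theory Num.Theory.
Import numFieldNormedType.Exports.

Local Open Scope classical_set_scope.
Local Open Scope ring_scope.

(** Put u(t) = c + int_0^t grad V . x', the gradient being taken in space at
    (tau(t), x(t)).  The equation becomes the first-order system
      x' = p,  p' = - 2 u grad V(tau, x),  u' = grad V(tau, x) . p,
    and p.p / 2 + u^2 is conserved along it, whatever tau is.  Hence the law
    p.p / 2 + tau'^2 / 4 = const holds as soon as tau' = 2 u.  Adding this
    equation closes the system: it is the motion of a charge in the space of
    the (tau, x), in a magnetic field with potential V dtau up to a constant.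

    Speeds being bounded by the conservation law, positions grow at most
    linearly in time and solutions are complete ([cut_solution_bound]).

    To join x0 to x1, change the time scale: with t = eps s the force is
    multiplied by eps.  Start from u(0) = 0, that is, choose c = 0.  When eps
    tends to 0 the trajectories tend to straight lines, so the one with initial
    velocity q reaches at time 1 the point x0 + q + E(q), where both the size
    and the Lipschitz constant of E are O(eps).  For small eps the map
    q |-> x1 - x0 - E(q) is a contraction, and its fixed point is the velocity
    that hits x1 ([shooting]).

    The contraction argument needs a flow that is defined up to time 1 for all
    initial velocities and depends on them in a Lipschitz way, whereas the force
    is only Lipschitz on balls.  The force is therefore multiplied by a cutoff
    equal to 1 on the ball of radius r0 + r1 |t|.  A scalar factor on the force
    does not destroy the conservation law, so the a priori bound holds for the
    cut system as well, with the same constants; for suitable r0 and r1 the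
    chosen trajectory thus stays where the cutoff is 1, and solves the original
    system.  The cut field is Lipschitz uniformly on bounded time intervals,
    which is what the global existence theorem ([picard]) and the stability
    estimate ([gronwall]) require.

    If V does not depend on time then int_0^t grad V . y' = V(y(t)) - V(x0) for
    every C^2 curve y issued from x0, so c plus the integral is V + cbar, the
    right-hand side of the equation is minus the gradient of (V + cbar)^2, and
    tau'^2 / 4 = u^2 is (V + cbar)^2. *)

(** * Products of complete normed spaces *)

HB.instance Definition _ (T U : pnbhsType) := Pointed.on (T * U)%type.
HB.instance Definition _ (T U : puniformType) := Pointed.on (T * U)%type.

(** Picard's iteration below takes its limit in the phase space, a product. *)
Lemma prod_complete (T U : completeType) (F : set_system (T * U)) :
  ProperFilter F -> cauchy F -> cvg F.
Proof.
move=> FF Fc.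
have c1 : cauchy (fst @ F).
  move=> A entA; rewrite near_simpl -near2E near_map2; apply: Fc.
  have := prod_entP entA (@entourageT U).
  by apply: filterS => -[[a b] [c d]] /= [].
have c2 : cauchy (snd @ F).
  move=> A entA; rewrite near_simpl -near2E near_map2; apply: Fc.
  have := prod_entP (@entourageT T) entA.
  by apply: filterS => -[[a b] [c d]] /= [].
apply/cvg_ex; exists (lim (fst @ F), lim (snd @ F)).
have c12 := cvg_pair (cauchy_cvg _ c1) (cauchy_cvg _ c2).
move=> A /c12 FA; suff : F [set x | A (x.1, x.2)] by apply: filterS => -[].
exact: FA.
Qed.

HB.instance Definition _ (T U : completeType) :=
  Uniform_isComplete.Build (T * U)%type (@prod_complete T U).
HB.instance Definition _ (R : numFieldType) (T U : completePseudoMetricType R)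
  := Uniform_isComplete.Build (T * U)%type cauchy_cvg.

HB.instance Definition _ (R : numFieldType) (T U : completeNormedModType R)
  := Complete.on (T * U)%type.
HB.instance Definition _ (R : realType) m n := Complete.on 'M[R]_(m, n).

(** * Derivatives, primitives and the mean value inequality for curves *)

Section calculus.
Variable R : realType.

Lemma is_derive_linear (E F : normedModType R) (l : {linear E -> F})
    (f : R -> E) (t : R) (d : E) :
  continuous l -> is_derive t 1 f d -> is_derive t 1 (l \o f) (l d).
Proof.
move=> cl [df <-]; have df' := (derivable1_diffP f t).1 df.
have dl : differentiable l (f t) by exact: linear_differentiable.
apply: DeriveDef; first exact/derivable1_diffP/differentiable_comp.
rewrite !deriveE //; last exact: differentiable_comp.
by rewrite diff_comp //= diff_lin.
Qed.

Lemma is_derive_fst (E F : normedModType R) (f : R -> E * F) (t : R) (d : E * F) :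
  is_derive t 1 f d -> is_derive t 1 (fun s => (f s).1) d.1.
Proof.
by apply: (@is_derive_linear _ _ fst) => -[x y]; exact: cvg_fst.
Qed.

Lemma is_derive_snd (E F : normedModType R) (f : R -> E * F) (t : R) (d : E * F) :
  is_derive t 1 f d -> is_derive t 1 (fun s => (f s).2) d.2.
Proof.
by apply: (@is_derive_linear _ _ snd) => -[x y]; exact: cvg_snd.
Qed.

Lemma is_derive_pair (E F : normedModType R) (f : R -> E) (g : R -> F) (t : R) d e :
  is_derive t 1 f d -> is_derive t 1 g e ->
  is_derive t 1 (fun s => (f s, g s)) (d, e).
Proof.
move=> [df <-] [dg <-].
have df' := (derivable1_diffP f t).1 df; have dg' := (derivable1_diffP g t).1 dg.
apply: DeriveDef; first exact/derivable1_diffP/differentiable_pair.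
rewrite !deriveE //; last exact: differentiable_pair.
by rewrite diff_pair.
Qed.

Lemma is_derive_rowP n (f : R -> 'rV[R]_n) (t : R) (d : 'rV[R]_n) :
  is_derive t 1 f d <-> forall i, is_derive t 1 (fun s => f s ord0 i) (d ord0 i).
Proof.
split=> [[df <-] i|H].
  apply: DeriveDef; first exact: (derivable_mxP f t 1).1 df ord0 i.
  by rewrite derive_mx // mxE.
have df : derivable f t 1.
  by apply/derivable_mxP => i j; rewrite (ord1 i); case: (H j).
apply: DeriveDef => //; rewrite derive_mx //; apply/rowP => j; rewrite mxE.
by case: (H j).
Qed.

Lemma is_derive_continuous (E : normedModType R) (f f' : R -> E) :
  (forall t : R, is_derive t 1 f (f' t)) -> continuous f.
Proof.
move=> H t; apply/differentiable_continuous/derivable1_diffP.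
by case: (H t).
Qed.

(** Existence of primitives and the mean value inequality are all that the
    theory of differential equations below asks of the space of values.  Both
    hold for the reals and pass to row vectors and products, whose norms are
    maxima of the norms of the components; this avoids vector-valued
    integrals. *)
Definition has_primitives (E : normedModType R) := forall f : R -> E,
  continuous f -> exists F, forall t : R, is_derive t 1 F (f t).

Definition mean_value_ineq (E : normedModType R) :=
  forall (f f' : R -> E) (h h' : R -> R),
    (forall t : R, is_derive t 1 f (f' t)) -> (forall t : R, is_derive t 1 h (h' t)) ->
    forall a b, a <= b -> (forall t, a <= t <= b -> `|f' t| <= h' t) ->
    `|f b - f a| <= h b - h a.

Lemma is_derive_nondecreasing (h h' : R -> R) (a b : R) :
  (forall t : R, is_derive t 1 h (h' t)) -> a <= b ->
  (forall t, a <= t <= b -> 0 <= h' t) -> h a <= h b.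
Proof.
move=> dh ab h0.
rewrite -subr_ge0; have [|c + ->] := @MVT_segment R h h' a b ab.
  by apply: continuous_subspaceT; exact: is_derive_continuous dh.
by rewrite in_itv /= => /h0 c0; rewrite mulr_ge0 // subr_ge0.
Qed.

Lemma mean_value_ineq_real : mean_value_ineq R.
Proof.
move=> f f' h h' df dh a b ab fh.
have le_incr (g g' : R -> R) : (forall t : R, is_derive t 1 g (g' t)) ->
    (forall t, a <= t <= b -> g' t <= h' t) -> g b - g a <= h b - h a.
  move=> dg gh; have dD t := is_deriveB (dh t) (dg t).
  have : h a - g a <= h b - g b.
    by apply: (is_derive_nondecreasing dD) => // t tab; rewrite subr_ge0 gh.
  by lra.
rewrite ler_norml; apply/andP; split; last first.
  by apply: (le_incr f f') => // t /fh; rewrite ler_norml => /andP[].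
have /= : - f b - - f a <= h b - h a.
  apply: (le_incr (- f) (fun t => - f' t)) => t.
  by move=> /fh; rewrite ler_norml lerNl => /andP[].
by lra.
Qed.

Lemma rV_norm_leP n (v : 'rV[R]_n) (e : R) : 0 <= e ->
  (`|v| <= e) <-> (forall i, `|v ord0 i| <= e).
Proof.
move=> e0; rewrite [`|v|]mx_normrE; split=> [H i|H].
  by apply: le_trans H; exact: (le_bigmax _ _ (ord0, i)).
by apply: bigmax_le => // -[i j] _ /=; rewrite (ord1 i).
Qed.

Lemma prod_norm_le (E F : normedModType R) (v : E * F) (e : R) :
  (`|v| <= e) = (`|v.1| <= e) && (`|v.2| <= e).
Proof. by rewrite prod_normE ge_max. Qed.

Lemma mean_value_ineq_rV n : mean_value_ineq 'rV[R]_n.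
Proof.
move=> f f' h h' df dh a b ab fh.
have h'0 t : a <= t <= b -> 0 <= h' t by move=> /fh; exact: le_trans.
apply/rV_norm_leP; first by rewrite subr_ge0; exact: is_derive_nondecreasing h'0.
move=> i; rewrite !mxE.
apply: (@mean_value_ineq_real (fun t => f t ord0 i) (fun t => f' t ord0 i) h h') => //.
  by move=> t; apply: (is_derive_rowP f t (f' t)).1.
by move=> t tab; have /rV_norm_leP := fh t tab; apply; exact: h'0.
Qed.

Lemma mean_value_ineq_prod (E F : normedModType R) :
  mean_value_ineq E -> mean_value_ineq F -> mean_value_ineq (E * F)%type.
Proof.
move=> mE mF f f' h h' df dh a b ab fh; rewrite prod_norm_le /=.
apply/andP; split.
  apply: (mE (fun t => (f t).1) (fun t => (f' t).1)) => //.
    by move=> t; exact: is_derive_fst.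
  by move=> t /fh; rewrite prod_norm_le => /andP[].
apply: (mF (fun t => (f t).2) (fun t => (f' t).2)) => //.
  by move=> t; exact: is_derive_snd.
by move=> t /fh; rewrite prod_norm_le => /andP[].
Qed.

Lemma has_primitives_rV n : has_primitives R -> has_primitives 'rV[R]_n.
Proof.
move=> pR f cf.
have /choice[F HF] (i : 'I_n) :
    exists F : R -> R, forall t : R, is_derive t 1 F (f t ord0 i).
  apply: pR => t.
  apply: (@continuous_comp _ _ _ f (fun v : 'rV[R]_n => v ord0 i)).
    exact: cf.
  exact: (@coord_continuous R 1 n ord0 i (f t)).
exists (fun t => \row_i F i t) => t; apply/is_derive_rowP => i.
by under eq_fun do rewrite mxE; exact: HF.
Qed.

Lemma has_primitives_prod (E F : normedModType R) :
  has_primitives E -> has_primitives F -> has_primitives (E * F)%type.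
Proof.
move=> pE pF f cf.
have [|G1 H1] := pE (fun t => (f t).1).
  by move=> t; apply: cvg_comp; [exact: cf|exact: cvg_fst].
have [|G2 H2] := pF (fun t => (f t).2).
  by move=> t; apply: cvg_comp; [exact: cf|exact: cvg_snd].
exists (fun t => (G1 t, G2 t)) => t.
by rewrite [f t]surjective_pairing; exact: is_derive_pair.
Qed.

(** An integral with a fixed lower bound is a primitive only to the right of
    that bound, hence the two half-line primitives glued in
    [has_primitives_real]. *)
Lemma primitive_right (f : R -> R) : continuous f ->
  exists F, forall t : R, -1 < t -> is_derive t 1 F (f t).
Proof.
move=> cf; exists (fun x => \int[lebesgue_measure]_(t in `[-1, x]) f t) => t t1.
have [||||H1 H2] := @continuous_FTC1_closed R f (-1) t (t + 1).
- by rewrite ltrDl.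
- apply: continuous_compact_integrable; first exact: segment_compact.
  exact: continuous_subspaceT.
- exact: t1.
- exact: cf.
by apply: DeriveDef; [exact: H1|rewrite -derive1E].
Qed.

(** A primitive on ]-1, +oo[ and one on ]-oo, 1[, the latter obtained from the
    former by reflection, differ by a constant on ]-1, 1[. *)
Lemma has_primitives_real : has_primitives R.
Proof.
move=> f cf; have [A dA] := primitive_right cf.
have [|B dB] := @primitive_right (fun t => f (- t)).
  by move=> t; apply: continuous_comp; [exact: opp_continuous|exact: cf].
have dB' (t : R) : t < 1 -> is_derive t 1 (fun s => - B (- s)) (f t).
  move=> t1; have t1' : -1 < - t by rewrite ltrN2.
  have := is_deriveN (@is_derive1_comp R B -%R t _ _ (dB _ t1') (is_deriveNid t 1)).
  by rewrite mulrN1 !opprK.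
have eqAB (t : R) : -1 < t < 1 -> A t - A 0 = - B (- t) + B (- 0).
  move=> t1; have dD (s : R) : -1 < s < 1 -> is_derive s 1 (A - (fun s => - B (- s))) 0.
    by move=> /andP[s1 s2]; have := is_deriveB (dA s s1) (dB' s s2); rewrite subrr.
  suff : forall s : R, `|s| < 1 -> (A - (fun s => - B (- s))) s = (A - (fun s => - B (- s))) 0.
    by move=> /(_ t); rewrite ltr_norml => /(_ t1); rewrite !fctE; lra.
  move=> s s1; move: (A - _) dD => D dD.
  have cD a b : -1 < a -> b < 1 -> {within `[a, b], continuous D}.
    move=> a1 b1; apply: derivable_within_continuous => x; rewrite in_itv /= => x1.
    by have [] : is_derive x 1 D 0 by apply: dD; lra.
  move: s1; rewrite ltr_norml; case: (leP 0 s) => s0 s1.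
    have [x|| c _] := @MVT_segment R D (cst 0) 0 s s0; last by rewrite /= mul0r; lra.
      by rewrite in_itv /= => x1; apply: dD; lra.
    by apply: cD; lra.
  have [x|| c _] := @MVT_segment R D (cst 0) s 0 (ltW s0); last by rewrite /= mul0r; lra.
    by rewrite in_itv /= => x1; apply: dD; lra.
  by apply: cD; lra.
exists (fun t => if 0 <= t then A t - A 0 else - B (- t) + B (- 0)) => t.
case: (leP 0 t) => t0.
  apply: (@near_eq_is_derive _ _ _ (fun t => A t - A 0)).
    have : \forall s \near t, -1 < s by apply: lt_nbhsr; lra.
    apply: filterS => s s1; case: leP => // s0.
    by rewrite -eqAB //; lra.
  have := is_deriveB (dA t _) (is_derive_cst (A 0) t 1); rewrite subr0; apply; lra.
apply: (@near_eq_is_derive _ _ _ (fun t => - B (- t) + B (- 0))).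
  have : \forall s \near t, s < 1 by apply: lt_nbhsl; lra.
  apply: filterS => s s1; case: leP => // s0.
  by rewrite -eqAB //; lra.
by have := is_deriveD (dB' t _) (is_derive_cst (B (- 0)) t 1); rewrite addr0; apply; lra.
Qed.

End calculus.

(** * Global solutions of Lipschitz differential equations *)

Section picard.
Variables (R : realType) (E : completeNormedModType R).
Hypothesis primE : has_primitives E.
Hypothesis mvE : mean_value_ineq E.

Lemma is_derive_expR_scale (c k t : R) :
  is_derive t 1 (fun s => c * expR (k * s)) (c * k * expR (k * t)).
Proof.
have dk : is_derive t 1 (fun s : R => k * s) k.
  exact: is_derive_eq (is_deriveZ k (is_derive_id t (1 : R))) (mulr1 k).
have dc := is_deriveZ c (@is_derive1_comp R expR (fun s => k * s) t _ _ (is_derive_expR _) dk).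
by apply: (is_derive_eq dc); rewrite -mulrA (mulrC k (expR _)).
Qed.

(** The inequality behind both [picard] and [gronwall]: on functions bounded by
    exp (k |t|), taking the primitive that vanishes at 0 divides the bound by
    k.  For k twice the Lipschitz constant, Picard's operator thus halves
    weighted distances, without restriction on the length of the interval. *)
Lemma exp_growth (f f' : R -> E) (A k t : R) :
  (forall s : R, is_derive s 1 f (f' s)) -> 0 < k ->
  (forall s, `|s| <= `|t| -> `|f' s| <= A * expR (k * `|s|)) ->
  `|f t - f 0| <= A / k * (expR (k * `|t|) - 1).
Proof.
move=> df k0 fA; have kN0 : k != 0 by rewrite gt_eqF.
have [t0|/ltW t0] := leP 0 t.
  have := mvE df (is_derive_expR_scale (A / k) k) t0.
  rewrite (ger0_norm t0) mulr0 expR0 mulrBr mulr1; apply => s /andP[s0 st].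
  have := fA s; rewrite !ger0_norm // divfK //; exact.
have H := mvE df (is_derive_expR_scale (- (A / k)) (- k)) t0.
rewrite distrC (ler0_norm t0) (_ : k * - t = - k * t); last by rewrite mulrN mulNr.
apply: le_trans (H _) _ => [s /andP[ts s0]|]; last first.
  by rewrite mulr0 expR0; lra.
have := fA s; rewrite !ler0_norm // lerN2 mulrNN divfK // mulrN mulNr; exact.
Qed.

(** Choosing primitives once and for all turns Picard's scheme into the
    iteration of an operator. *)
Lemma primitive_operator : exists P : (R -> E) -> R -> E,
  forall f, continuous f ->
    P f 0 = 0 /\ (forall t : R, is_derive t 1 (P f) (f t)).
Proof.
suff /choice[P HP] : forall f : R -> E, exists F : R -> E, continuous f ->
    F 0 = 0 /\ (forall t : R, is_derive t 1 F (f t)) by exists P.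
move=> f; have [cf|ncf] := pselect (continuous f); last by exists (cst 0).
have [F dF] := primE cf; exists (fun t => F t - F 0) => _; split.
  by rewrite subrr.
move=> t; have := is_deriveB (dF t) (is_derive_cst (F 0) t 1).
by rewrite subr0.
Qed.

Lemma half_pow_le0 (x K : R) : (forall k, x <= K / 2 ^+ k) -> x <= 0.
Proof.
move=> H; rewrite leNgt; apply/negP => x0.
have K0 : 0 < K by have := H 0; rewrite expr0 divr1; exact: lt_le_trans.
have /cvgrPdist_lt /(_ _ x0) : geometric K (2^-1 : R) @ \oo --> (0 : R).
  by apply: cvg_geometric; rewrite ger0_norm ?invf_lt1 ?ltr1n.
move=> [N _ /(_ N (leqnn N))] /=; rewrite sub0r normrN.
rewrite exprVn ger0_norm ?divr_ge0 ?exprn_ge0 // ?(ltW K0) //.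
by rewrite ltNge H.
Qed.

Lemma geometric_cauchy (u : nat -> E) (C : R) :
  (forall k, `|u k.+1 - u k| <= C / 2 ^+ k) ->
  forall k, `|limn u - u k| <= 2 * C / 2 ^+ k.
Proof.
move=> H.
have p0 k : 0 < (2 : R) ^+ k by rewrite exprn_gt0.
have step k m : `|u (k + m)%N - u k| <= 2 * C / 2 ^+ k - 2 * C / 2 ^+ (k + m).
  elim: m => [|m IH]; first by rewrite addn0 !subrr normr0.
  rewrite addnS -(subrKA (u (k + m)%N)).
  apply: le_trans (ler_normD _ _) _; apply: le_trans (lerD (H _) IH) _.
  rewrite exprS.
  have -> : 2 * C / (2 * 2 ^+ (k + m)) = C / 2 ^+ (k + m).
    by field; rewrite gt_eqF.
  lra.
have C0 : 0 <= C.
  by have := H 0; rewrite expr0 divr1; apply: le_trans.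
have bnd k m : `|u (k + m)%N - u k| <= 2 * C / 2 ^+ k.
  apply: le_trans (step k m) _; by rewrite gerBl divr_ge0 ?mulr_ge0 ?exprn_ge0.
have cvu : cvgn u.
  apply: cauchy_cvg; apply: cauchy_exP => e e0.
  have [k ke] : exists k, 2 * C / 2 ^+ k < e.
    apply: contrapT => /forallNP Hk.
    have /half_pow_le0 : forall k, e <= 2 * C / 2 ^+ k.
      by move=> k; rewrite leNgt; apply/negP/Hk.
    by rewrite leNgt e0.
  exists (u k); exists k => //= m km.
  rewrite -ball_normE /= distrC; apply: le_lt_trans ke.
  by rewrite -(subnKC km).
move=> k; apply/ler_addgt0Pr => e e0.
have /cvgrPdist_lt /(_ _ e0)[N _ HN] := cvu.
rewrite -(subrKA (u (k + N)%N)) addrC.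
apply: le_trans (ler_normD _ _) _; apply: lerD; first exact: bnd.
by apply/ltW/HN => /=; rewrite leq_addl.
Qed.

Lemma continuous_bounded_itv (f : R -> R) (T : R) : continuous f ->
  exists M, forall s, `|s| <= T -> f s <= M.
Proof.
move=> cf; have [T0|T0] := leP 0 T; last first.
  by exists 0 => s /le_lt_trans /(_ T0); rewrite normr_lt0.
have [||c _ H] := @EVT_max R f (- T) T.
- lra.
- exact: continuous_subspaceT.
by exists (f c) => s; rewrite ler_norml => sT; apply: H; rewrite in_itv.
Qed.

Variable F : R -> E -> E.
Hypothesis contF : forall y : R -> E, continuous y -> continuous (fun t => F t (y t)).
Hypothesis lipF : forall T, exists2 L, 0 < L &
  forall t a b, `|t| <= T -> `|F t a - F t b| <= L * `|a - b|.

(** The iterates converge geometrically, uniformly on each [-T, T], with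
    constants that depend on T; the limit is a fixed point of the operator on
    the whole line. *)
Lemma picard (a : E) : exists y : R -> E,
  y 0 = a /\ forall t : R, is_derive t 1 y (F t (y t)).
Proof.
have [P HP] := primitive_operator.
pose S (y : R -> E) : R -> E := fun t => a + P (fun s => F s (y s)) t.
pose y_ k := iter k S (cst a).
have dS y : continuous y -> forall t : R, is_derive t 1 (S y) (F t (y t)).
  move=> cy t; have [_ dP] := HP _ (contF cy).
  by have := is_deriveD (is_derive_cst a t 1) (dP t); rewrite add0r.
have S0 y : continuous y -> S y 0 = a.
  by move=> cy; rewrite /S; have [-> _] := HP _ (contF cy); rewrite addr0.
have cy_ k : continuous (y_ k).
  elim: k => [|k IH]; first by move=> t; exact: cvg_cst.
  exact: is_derive_continuous (dS _ IH).
have dSB y z (cy : continuous y) (cz : continuous z) (t : R) :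
    is_derive t 1 (S y - S z) (F t (y t) - F t (z t)).
  exact: is_deriveB (dS _ cy t) (dS _ cz t).
have growth y z (A k t : R) : continuous y -> continuous z -> 0 < k -> 0 <= A ->
    (forall s, `|s| <= `|t| -> `|F s (y s) - F s (z s)| <= A * expR (k * `|s|)) ->
    `|S y t - S z t| <= A / k * expR (k * `|t|).
  move=> cy cz k0 A0 H; have := exp_growth (dSB _ _ cy cz) k0 H.
  rewrite !fctE !S0 // subrr subr0 => /le_trans; apply.
  by rewrite ler_wpM2l ?divr_ge0 // ?(ltW k0) // gerBl.
have unif T : exists C, forall t, `|t| <= T ->
    forall k, `|y_ k.+1 t - y_ k t| <= C / 2 ^+ k.
  have [L L0 HL] := lipF T.
  have [M HM] : exists M, forall s, `|s| <= T -> `|F s a| <= M.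
    apply: (@continuous_bounded_itv (fun s => `|F s a|)) => t.
    apply: cvg_norm; apply: (contF (y := cst a)) => ?; exact: cvg_cst.
  have [T0|T0] := leP 0 T; last first.
    by exists 0 => s /le_lt_trans /(_ T0); rewrite normr_lt0.
  have M0 : 0 <= M by apply: le_trans (HM 0 _); rewrite ?normr0.
  pose C := M / (2 * L).
  have C0 : 0 <= C by rewrite divr_ge0 // mulr_ge0 // ltW.
  have L2 : 0 < 2 * L by rewrite mulr_gt0.
  have expL (s : R) : 1 <= expR (2 * L * `|s|).
    by rewrite -[leLHS]expR0 ler_expR mulr_ge0 // ltW.
  suff H k t : `|t| <= T ->
      `|y_ k.+1 t - y_ k t| <= C / 2 ^+ k * expR (2 * L * `|t|).
    exists (C * expR (2 * L * T)) => t tT k; apply: le_trans (H k t tT) _.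
    rewrite mulrAC ler_wpM2r ?invr_ge0 ?exprn_ge0 // ler_wpM2l //.
    by rewrite ler_expR ler_wpM2l // ltW.
  elim: k t => [|k IH] t tT.
    have dS0 : forall s : R, is_derive s 1 (S (cst a)) (F s a).
      by move=> s; apply: dS => ?; exact: cvg_cst.
    have := @exp_growth _ _ M _ t dS0 L2 _.
    rewrite S0; last by move=> ?; exact: cvg_cst.
    rewrite expr0 divr1 => H; apply: le_trans (H _) _.
      move=> s st; apply: le_trans (HM _ (le_trans st tT)) _.
      by rewrite ler_peMr.
    by rewrite ler_wpM2l // gerBl.
  (* The weight exp (2 L |t|) turns the factor L into L / (2 L). *)
  have -> : C / 2 ^+ k.+1 = L * (C / 2 ^+ k) / (2 * L).
    by rewrite exprS; field; rewrite !gt_eqF ?exprn_gt0.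
  apply: (growth _ _ _ _ _ (cy_ k.+1) (cy_ k) L2).
  - by rewrite mulr_ge0 ?divr_ge0 ?exprn_ge0 // ltW.
  - move=> s st; have sT := le_trans st tT.
    by apply: le_trans (HL _ _ _ sT) _; rewrite -mulrA ler_wpM2l ?IH // ltW.
pose y t := limn (y_ ^~ t).
have yE T : exists2 C, 0 <= C & forall t, `|t| <= T ->
    forall k, `|y t - y_ k t| <= C / 2 ^+ k.
  have [C HC] := unif T.
  have [T0|T0] := leP 0 T; last first.
    by exists 0 => // s /le_lt_trans /(_ T0); rewrite normr_lt0.
  exists (2 * C) => [|t tT k].
    rewrite mulr_ge0 //.
    have := HC 0; rewrite normr0 => /(_ T0 0).
    by rewrite expr0 divr1; apply: le_trans.
  by apply: geometric_cauchy => j; exact: HC.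
have cy : continuous y.
  move=> t; have [C C0 HC] := yE (`|t| + 1).
  apply/cvgrPdist_lt => e e0; have e3 : 0 < e / 3 by rewrite divr_gt0.
  have [k ke] : exists k, C / 2 ^+ k < e / 3.
    apply: contrapT => /forallNP Hk.
    have /half_pow_le0 : forall k, e / 3 <= C / 2 ^+ k.
      by move=> k; rewrite leNgt; apply/negP/Hk.
    by rewrite leNgt e3.
  have /cvgrPdist_lt /(_ _ e3) := cy_ k t.
  have : \forall s \near t, `|t - s| < 1.
    by near=> s; near: s; exact: (nbhsx_ballx t (1 : R) ltr01).
  apply: filterS2 => s ts H.
  have sT : `|s| <= `|t| + 1.
    rewrite -(subKr t s); apply: le_trans (ler_normB _ _) _.
    by rewrite lerD2l ltW.
  have tT : `|t| <= `|t| + 1 by rewrite lerDl.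
  have H1 := le_lt_trans (HC t tT k) ke.
  have H2 := le_lt_trans (HC s sT k) ke.
  rewrite (_ : y t - y s =
    (y t - y_ k t) + ((y_ k t - y_ k s) - (y s - y_ k s))); last first.
    by rewrite opprB !subrKA.
  apply: le_lt_trans (ler_normD _ _) _.
  have := ler_normB (y_ k t - y_ k s) (y s - y_ k s).
  lra.
have fix_y : y = S y.
  apply/funext => t; apply/eqP; rewrite -subr_eq0 -normr_le0; apply/eqP.
  have [C C0 HC] := yE `|t|; have [L L0 HL] := lipF `|t|.
  apply/eqP; apply: (@half_pow_le0 _ (C + L * C * expR `|t|)) => k.
  have -> : y t - S y t = (y t - y_ k.+1 t) - (S y t - S (y_ k) t).
    by rewrite opprB; apply/esym; exact: (subrKA (S (y_ k) t)).
  apply: le_trans (ler_normB _ _) _; rewrite mulrDl; apply: lerD.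
    apply: le_trans (HC t (lexx _) k.+1) _.
    rewrite ler_wpM2l // lef_pV2 ?posrE ?exprn_gt0 //.
    by rewrite exprS ler_peMl ?exprn_ge0 // ler1n.
  have : `|S y t - S (y_ k) t| <= L * (C / 2 ^+ k) / 1 * expR (1 * `|t|).
    apply: (growth _ _ _ _ _ cy (cy_ k) ltr01).
      by rewrite mulr_ge0 ?divr_ge0 ?exprn_ge0 // ltW.
    move=> s st; apply: le_trans (HL _ _ _ st) _; rewrite -mulrA.
    rewrite ler_wpM2l ?(ltW L0) //; apply: le_trans (HC s st k) _.
    rewrite ler_peMr ?divr_ge0 ?exprn_ge0 //.
    by rewrite -[leLHS]expR0 ler_expR mul1r.
  by rewrite divr1 mul1r mulrA mulrAC.
exists y; split; first by rewrite fix_y S0.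
by move=> t; rewrite {1}fix_y; exact: dS.
Unshelve. all: by end_near. Qed.

(** If m is the maximum over [-T, T] of |y - z| exp (- 2 L |t|), then
    [exp_growth] gives m <= |y(0) - z(0)| + m / 2. *)
Lemma gronwall (y z : R -> E) (T L : R) : 0 < L ->
  (forall t : R, is_derive t 1 y (F t (y t))) ->
  (forall t : R, is_derive t 1 z (F t (z t))) ->
  (forall t a b, `|t| <= T -> `|F t a - F t b| <= L * `|a - b|) ->
  forall t, `|t| <= T -> `|y t - z t| <= 2 * `|y 0 - z 0| * expR (2 * L * `|t|).
Proof.
move=> L0 dy dz lip t0 t0T.
have T0 : 0 <= T by apply: le_trans t0T.
have L2 : 0 < 2 * L by rewrite mulr_gt0.
pose phi t := `|y t - z t| * expR (- (2 * L * `|t|)).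
have cphi : continuous phi.
  move=> t; apply: cvgM.
    apply: cvg_norm; apply: cvgB; first exact: is_derive_continuous dy t.
    exact: is_derive_continuous dz t.
  apply: (@continuous_comp _ _ _ (fun t => - (2 * L * `|t|)) expR); last first.
    exact: continuous_expR.
  apply: cvgN; apply: cvgM; first exact: cvg_cst.
  exact: norm_continuous.
have [||c cT H] := @EVT_max R phi (- T) T.
- lra.
- exact: continuous_subspaceT.
have {}cT : `|c| <= T by move: cT; rewrite in_itv /= ler_norml.
have {}H s : `|s| <= T -> `|y s - z s| <= phi c * expR (2 * L * `|s|).
  move=> sT; have /H : s \in `[- T, T]%R by rewrite in_itv /= -ler_norml.
  rewrite {1}/phi expRN -ler_pdivlMr ?invr_gt0 ?expR_gt0 //.
  by rewrite invrK.
suff : phi c <= 2 * `|y 0 - z 0|.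
  move=> m; apply: le_trans (H _ t0T) _.
  by rewrite ler_wpM2r // expR_ge0.
have := @exp_growth (y - z) _ (L * phi c) (2 * L) c
  (fun t => is_deriveB (dy t) (dz t)) L2 _.
rewrite !fctE => G.
have {}G : `|y c - z c| <= `|y 0 - z 0| + phi c / 2 * expR (2 * L * `|c|).
  rewrite -(subrK (y 0 - z 0) (y c - z c)); apply: le_trans (ler_normD _ _) _.
  rewrite addrC lerD2l; apply: le_trans (G _) _.
    move=> s sc; have sT := le_trans sc cT.
    by apply: le_trans (lip _ _ _ sT) _; rewrite -mulrA ler_wpM2l ?H // ltW.
  have -> : L * phi c / (2 * L) = phi c / 2 by field; rewrite gt_eqF.
  rewrite ler_wpM2l ?gerBl // divr_ge0 // mulr_ge0 // expR_ge0.
have : phi c <= `|y 0 - z 0| + phi c / 2; last lra.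
rewrite {1}/phi expRN ler_pdivrMr ?expR_gt0 //; apply: le_trans G _.
rewrite [leRHS]mulrDl lerD2r ler_peMr // -[leLHS]expR0 ler_expR mulr_ge0 // ltW //.
Qed.

End picard.

(** * Maps that are Lipschitz on balls, and cutoffs *)

Section lip_on_balls.
Variable R : realType.

Definition lip_on_balls (E F : normedModType R) (f : E -> F) :=
  forall r, exists2 C, 0 <= C &
    forall a b, `|a| <= r -> `|b| <= r -> `|f a - f b| <= C * `|a - b|.

Lemma lip_on_balls_bounded (E F : normedModType R) (f : E -> F) :
  lip_on_balls f -> forall r, exists2 M, 0 <= M & forall a, `|a| <= r -> `|f a| <= M.
Proof.
move=> lf r; have [C C0 HC] := lf r; exists (`|f 0| + C * `|r|) => [|a ar].
  by rewrite addr_ge0 // mulr_ge0.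
have r0 : 0 <= r by apply: le_trans ar.
rewrite -(subrK (f 0) (f a)) addrC; apply: le_trans (ler_normD _ _) _.
rewrite lerD2l; apply: le_trans (HC a 0 ar _) _; first by rewrite normr0.
by rewrite subr0 (ger0_norm r0) ler_wpM2l.
Qed.

Lemma lip_on_balls_continuous (E F : normedModType R) (f : E -> F) :
  lip_on_balls f -> continuous f.
Proof.
move=> lf a; have [C C0 HC] := lf (`|a| + 1).
apply/cvgrPdist_lt => e e0.
pose d := Num.min 1 (e / (C + 1)).
have C1 : 0 < C + 1 by lra.
have d0 : 0 < d by rewrite lt_min ltr01 divr_gt0.
have /cvgrPdist_lt /(_ _ d0) := @cvg_id _ (nbhs a).
apply: filterS => b; rewrite lt_min => /andP[ab1 ab].
have br : `|b| <= `|a| + 1.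
  rewrite -(subKr a b); apply: le_trans (ler_normB _ _) _.
  by rewrite lerD2l ltW.
apply: le_lt_trans (HC a b _ br) _; first by rewrite lerDl.
move: ab; rewrite ltr_pdivlMr //; apply: le_lt_trans.
by rewrite mulrDr mulr1 mulrC lerDl.
Qed.

Lemma lip_on_balls_cst (E F : normedModType R) (c : F) :
  lip_on_balls (fun _ : E => c).
Proof. by move=> r; exists 0 => // a b _ _; rewrite subrr normr0 mul0r. Qed.

Lemma lip_on_balls_sum (E F : normedModType R) n (f : 'I_n -> E -> F) :
  (forall i, lip_on_balls (f i)) -> lip_on_balls (fun a => \sum_i f i a).
Proof.
move=> lf r.
have /choice[C HC] i : exists C, 0 <= C /\
    forall a b, `|a| <= r -> `|b| <= r -> `|f i a - f i b| <= C * `|a - b|.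
  by have [C C0 HC] := lf i r; exists C.
exists (\sum_i C i) => [|a b ar br].
  by apply: sumr_ge0 => i _; case: (HC i).
rewrite -sumrB mulr_suml; apply: le_trans (ler_norm_sum _ _ _) _.
by apply: ler_sum => i _; case: (HC i) => _; apply.
Qed.

Lemma lip_on_ballsZ (E F : normedModType R) (f : E -> R) (g : E -> F) :
  lip_on_balls f -> lip_on_balls g -> lip_on_balls (fun a => f a *: g a).
Proof.
move=> lf lg r; have [C C0 HC] := lf r; have [D D0 HD] := lg r.
have [M M0 HM] := lip_on_balls_bounded lf r.
have [N N0 HN] := lip_on_balls_bounded lg r.
exists (M * D + C * N) => [|a b ar br]; first by rewrite addr_ge0 ?mulr_ge0.
have -> : f a *: g a - f b *: g b = f a *: (g a - g b) + (f a - f b) *: g b.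
  by rewrite scalerBr scalerBl addrA subrK.
apply: le_trans (ler_normD _ _) _; rewrite !normrZ mulrDl; apply: lerD.
  by rewrite -mulrA ler_pM ?HM ?HD.
by rewrite mulrAC ler_pM ?HC ?HN.
Qed.

Lemma lip_on_balls_row (E : normedModType R) n (f : E -> 'rV[R]_n) :
  (forall i, lip_on_balls (fun a => f a ord0 i : R)) -> lip_on_balls f.
Proof.
move=> lf r.
have /choice[C HC] i : exists C, 0 <= C /\
    forall a b, `|a| <= r -> `|b| <= r ->
      `|f a ord0 i - f b ord0 i| <= C * `|a - b|.
  by have [C C0 HC] := lf i r; exists C.
have S0 : 0 <= \sum_i C i by apply: sumr_ge0 => i _; case: (HC i).
exists (\sum_i C i) => // a b ar br.
apply/rV_norm_leP; first by rewrite mulr_ge0.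
move=> i; rewrite !mxE; have [_ /(_ a b ar br) H] := HC i.
apply: le_trans H _; rewrite ler_wpM2r // (bigD1 i) //= lerDl.
by apply: sumr_ge0 => j _; case: (HC j).
Qed.

Lemma lip_on_balls_pair (E F G : normedModType R) (f : E -> F) (g : E -> G) :
  lip_on_balls f -> lip_on_balls g -> lip_on_balls (fun a => (f a, g a)).
Proof.
move=> lf lg r; have [C C0 HC] := lf r; have [D D0 HD] := lg r.
exists (C + D); first exact: addr_ge0.
move=> a b ar br; rewrite prod_norm_le /=; apply/andP; split.
  by apply: le_trans (HC a b ar br) _; rewrite ler_wpM2r // lerDl.
by apply: le_trans (HD a b ar br) _; rewrite ler_wpM2r // lerDr.
Qed.

Lemma lip_on_balls_comp (E F G : normedModType R) (p : {linear E -> F}) (f : F -> G) :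
  (forall a, `|p a| <= `|a|) -> lip_on_balls f -> lip_on_balls (f \o p).
Proof.
move=> p1 lf r; have [C C0 HC] := lf r; exists C => // a b ar br /=.
apply: le_trans (HC _ _ (le_trans (p1 a) ar) (le_trans (p1 b) br)) _.
by rewrite -linearB ler_wpM2l.
Qed.

Lemma norm_fst_le (E F : normedModType R) (a : E * F) : `|a.1| <= `|a|.
Proof. by have := lexx `|a|; rewrite {1}prod_norm_le => /andP[]. Qed.

Lemma norm_snd_le (E F : normedModType R) (a : E * F) : `|a.2| <= `|a|.
Proof. by have := lexx `|a|; rewrite {1}prod_norm_le => /andP[]. Qed.

Lemma norm_coord_le n (v : 'rV[R]_n) i : `|v ord0 i| <= `|v|.
Proof. by have /rV_norm_leP := lexx `|v|; apply. Qed.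

Lemma lip_on_balls_coord (E : normedModType R) n (f : E -> 'rV[R]_n) i :
  lip_on_balls f -> lip_on_balls (fun a => f a ord0 i : R).
Proof.
move=> lf r; have [C C0 HC] := lf r; exists C => // a b ar br.
apply: le_trans (HC a b ar br); have := norm_coord_le (f a - f b) i.
by rewrite !mxE.
Qed.

Lemma lip_on_balls_id (E : normedModType R) : lip_on_balls (fun a : E => a).
Proof. by move=> r; exists 1 => // a b _ _; rewrite mul1r. Qed.

(** Equal to 1 on the ball of radius rho, to 0 outside that of radius rho + 1. *)
Definition cutoff (E : normedModType R) (rho : R) (a : E) : R :=
  Num.max 0 (Num.min 1 (rho + 1 - `|a|)).

Lemma cutoff_ge0 (E : normedModType R) rho (a : E) : 0 <= cutoff rho a.
Proof. by rewrite le_max lexx. Qed.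

Lemma cutoff_le1 (E : normedModType R) rho (a : E) : cutoff rho a <= 1.
Proof. by rewrite ge_max ler01 ge_min lexx. Qed.

Lemma cutoff_eq1 (E : normedModType R) rho (a : E) : `|a| <= rho -> cutoff rho a = 1.
Proof.
by move=> ar; rewrite /cutoff min_l ?max_r //; lra.
Qed.

Lemma cutoff_eq0 (E : normedModType R) rho (a : E) : rho + 1 <= `|a| -> cutoff rho a = 0.
Proof.
move=> ar; rewrite /cutoff max_l // ge_min; apply/orP; right; lra.
Qed.

Lemma cutoff_lip (E : normedModType R) rho sigma (a b : E) :
  `|cutoff rho a - cutoff sigma b| <= `|rho - sigma| + `|a - b|.
Proof.
have := ler_dist_dist a b.
rewrite /cutoff; set x := `|a|; set y := `|b|; set z := `|a - b| => H.
have rs := ler_norm (rho - sigma); have sr := ler_norm (sigma - rho).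
rewrite distrC in sr; move: H rs sr; rewrite !ler_norml; set w := `|rho - sigma|.
move=> /andP[H1 H2] rs sr.
rewrite /Order.max /Order.min /=.
by do !case: ifPn => //; rewrite -?leNgt => *; apply/andP; split; lra.
Qed.

(** The product is Lipschitz on the whole space: when only one of two points
    lies where the cutoff may be nonzero, the bound of k on the ball of radius
    r + 1 takes the place of its Lipschitz constant.  The constant depends only
    on an upper bound of the radius, which makes radii growing with time
    admissible. *)
Lemma cutoff_scale_lip (E F : normedModType R) (k : E -> F) : lip_on_balls k ->
  forall r, exists2 C, 0 <= C &
    forall rho, rho <= r -> forall a b,
      `|cutoff rho a *: k a| <= C /\
      `|cutoff rho a *: k a - cutoff rho b *: k b| <= C * `|a - b|.
Proof.
move=> lk r; have [C C0 HC] := lk (r + 1).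
have [M M0 HM] := lip_on_balls_bounded lk (r + 1).
exists (C + M) => [|rho rr a b]; first exact: addr_ge0.
have out (c : E) : ~~ (`|c| <= r + 1) -> cutoff rho c = 0.
  by rewrite -ltNge => cr; apply: cutoff_eq0; lra.
have nc (c : E) : `|cutoff rho c| = cutoff rho c by rewrite ger0_norm ?cutoff_ge0.
split.
  have [ar|/out ->] := boolP (`|a| <= r + 1); last by rewrite scale0r normr0 addr_ge0.
  rewrite normrZ nc; apply: le_trans (_ : 1 * M <= _); last by rewrite mul1r lerDr.
  by rewrite ler_pM ?cutoff_ge0 ?cutoff_le1 ?HM.
have lipc : `|cutoff rho a - cutoff rho b| <= `|a - b|.
  by have := cutoff_lip rho rho a b; rewrite subrr normr0 add0r.
have [ar|/out a0] := boolP (`|a| <= r + 1); last first.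
  rewrite a0 scale0r sub0r normrN.
  have [br|/out ->] := boolP (`|b| <= r + 1); last first.
    by rewrite scale0r normr0 mulr_ge0 // addr_ge0.
  move: lipc; rewrite a0 sub0r normrN => lipc; rewrite normrZ mulrC.
  by rewrite ler_pM ?HM //; apply: le_trans (HM b br) _; rewrite lerDr.
have [br|/out b0] := boolP (`|b| <= r + 1); last first.
  move: lipc; rewrite b0 scale0r !subr0 => lipc; rewrite normrZ mulrC.
  by rewrite ler_pM ?HM //; apply: le_trans (HM a ar) _; rewrite lerDr.
have -> : cutoff rho a *: k a - cutoff rho b *: k b =
    cutoff rho a *: (k a - k b) + (cutoff rho a - cutoff rho b) *: k b.
  by rewrite scalerBr scalerBl addrA subrK.
apply: le_trans (ler_normD _ _) _; rewrite !normrZ nc mulrDl; apply: lerD.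
  apply: le_trans (HC a b ar br); rewrite ler_piMl // cutoff_le1 //.
by rewrite mulrC ler_pM ?HM.
Qed.

Lemma is_derive_along (E F : normedModType R) (f : E -> F) (g : R -> E) (t : R) (d : E) :
  differentiable f (g t) -> is_derive t 1 g d ->
  is_derive t 1 (f \o g) ('D_d f (g t)).
Proof.
move=> df [dg <-]; have dg' := (derivable1_diffP g t).1 dg.
apply: DeriveDef; first exact/derivable1_diffP/differentiable_comp.
rewrite !deriveE //; last exact: differentiable_comp.
by rewrite diff_comp.
Qed.

Section C1.
Variable n : nat.
Let Z := (R * 'rV[R]_n)%type.

Lemma compact_ball_prod (r : R) : compact [set a : Z | `|a| <= r].
Proof.
have -> : [set a : Z | `|a| <= r] =
    [set s : R | `|s| <= r] `*` [set x : 'rV[R]_n | `|x| <= r].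
  by apply/seteqP; split => a /=; rewrite prod_norm_le => /andP.
apply: compact_setX.
  have -> : [set s : R | `|s| <= r] = `[- r, r]%classic.
    by apply/seteqP; split => s /=; rewrite in_itv /= ler_norml.
  exact: segment_compact.
apply: bounded_closed_compact.
  exists r; split; first exact: num_real.
  by move=> x rx y /= yr; apply: le_trans yr (ltW rx).
apply: (@closed_comp _ _ (fun x : 'rV[R]_n => `|x|) [set s | s <= r]).
  by move=> x _; exact: norm_continuous.
exact: closed_le.
Qed.

Lemma continuous_bounded_ball (f : Z -> R) (r : R) : continuous f ->
  exists2 M, 0 <= M & forall a, `|a| <= r -> `|f a| <= M.
Proof.
move=> cf; have [r0|r0] := leP 0 r; last first.
  by exists 0 => // a /le_lt_trans /(_ r0); rewrite normr_lt0.
have [||c _ H] := @compact_EVT_max _ R (fun a => `|f a|) _ _ (@compact_ball_prod r).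
- by exists 0; rewrite /= normr0.
- by apply: continuous_subspaceT => a; apply: cvg_norm; exact: cf.
by exists `|f c| => // a ar; apply: H; rewrite inE.
Qed.

Lemma derive_coordinates (f : Z -> R) (a w : Z) : differentiable f a ->
  'D_w f a = w.1 * 'D_(1, 0) f a +
             \sum_i w.2 ord0 i * 'D_(0, delta_mx ord0 i) f a.
Proof.
move=> df; rewrite !deriveE //.
have wE : w = w.1 *: (1, 0) + \sum_i w.2 ord0 i *: (0, delta_mx ord0 i).
  apply: injective_projections => /=.
    rewrite (raddf_sum fst) big1 => [|i _]; last exact: mulr0.
    by rewrite addr0 /GRing.scale /= mulr1.
  rewrite (raddf_sum snd) scaler0 add0r [LHS]row_sum_delta.
  by apply: eq_bigr.
rewrite {1}wE linearD linearZ /= linear_sum; congr (_ + _).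
by apply: eq_bigr => i _; rewrite linearZ deriveE.
Qed.

(** On a ball, which is convex and compact, the partial derivatives are bounded;
    conclude by the mean value inequality on segments. *)
Lemma C1_lip_on_balls (f : Z -> R) : classC 1 f -> lip_on_balls f.
Proof.
move=> [df cf] r.
have [M M0 HM] := continuous_bounded_ball r (cf (1, 0)).
have /choice[N HN] (i : 'I_n) : exists N, 0 <= N /\
    forall a : Z, `|a| <= r -> `|'D_(0, delta_mx ord0 i) f a| <= N.
  by have [N N0 HN] := continuous_bounded_ball r (cf (0, delta_mx ord0 i)); exists N.
have S0 : 0 <= \sum_i N i by apply: sumr_ge0 => i _; case: (HN i).
exists (M + \sum_i N i) => [|a b ar br]; first exact: addr_ge0.
have dw c w : `|c| <= r -> `|'D_w f c| <= (M + \sum_i N i) * `|w|.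
  move=> cr; rewrite derive_coordinates //.
  apply: le_trans (ler_normD _ _) _; rewrite mulrDl; apply: lerD.
    by rewrite normrM mulrC ler_pM ?HM ?norm_fst_le.
  apply: le_trans (ler_norm_sum _ _ _) _; rewrite mulr_suml; apply: ler_sum => i _.
  rewrite normrM mulrC ler_pM ?(HN i).2 //.
  exact: le_trans (norm_coord_le _ _) (norm_snd_le _).
pose g (s : R) := b + s *: (a - b).
have dg (s : R) : is_derive s 1 g (a - b).
  have ds : is_derive s 1 ( *:%R ^~ (a - b)) (a - b).
    have dZ := is_diff_scalel s (a - b); apply: DeriveDef.
      by apply/derivable1_diffP.
    by rewrite deriveE // diff_val /= scale1r.
  by have := is_deriveD (is_derive_cst b s 1) ds; rewrite add0r.
have dfg (s : R) := is_derive_along (df (g s)) (dg s).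
have dh (s : R) : is_derive s 1 (fun s : R => (M + \sum_i N i) * `|a - b| * s)
    ((M + \sum_i N i) * `|a - b|).
  exact: is_derive_eq (is_deriveZ _ (is_derive_id s (1 : R))) (mulr1 _).
have := @mean_value_ineq_real R _ _ _ _ dfg dh 0 1 ler01.
rewrite /= /g scale0r addr0 scale1r subrKC mulr1 mulr0 subr0; apply.
move=> s /andP[s0 s1]; apply: dw.
have -> : b + s *: (a - b) = (1 - s) *: b + s *: a.
  by rewrite scalerBr scalerBl scale1r addrA addrAC.
apply: le_trans (ler_normD _ _) _; rewrite !normrZ !ger0_norm ?subr_ge0 //.
have := ler_wpM2l s0 ar; have := ler_wpM2l (_ : 0 <= 1 - s) br; lra.
Qed.

End C1.
End lip_on_balls.

(** * Conservation of energy *)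

Section dot.
Variables (R : realType) (n : nat).

Lemma is_derive_dotv (f g : R -> 'rV[R]_n) (t : R) (d e : 'rV[R]_n) :
  is_derive t 1 f d -> is_derive t 1 g e ->
  is_derive t 1 (fun s => dotv (f s) (g s)) (dotv (f t) e + dotv (g t) d).
Proof.
move=> /is_derive_rowP df /is_derive_rowP dg.
have -> : (fun s => dotv (f s) (g s)) =
    \sum_i ((fun s => f s ord0 i) * (fun s => g s ord0 i)).
  by apply/funext => s; rewrite fct_sumE.
apply: is_derive_eq (is_derive_sum (fun i => is_deriveM (df i) (dg i))) _.
by rewrite big_split.
Qed.

Lemma dotvC (u v : 'rV[R]_n) : dotv u v = dotv v u.
Proof. by apply: eq_bigr => i _; rewrite mulrC. Qed.

Lemma dotvZl (a : R) (u v : 'rV[R]_n) : dotv (a *: u) v = a * dotv u v.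
Proof. by rewrite /dotv mulr_sumr; apply: eq_bigr => i _; rewrite mxE mulrA. Qed.

Lemma sqr_coord_le_dotv (u : 'rV[R]_n) i : u ord0 i ^+ 2 <= dotv u u.
Proof.
rewrite /dotv (bigD1 i) //= expr2 lerDl.
by apply: sumr_ge0 => j _; rewrite -expr2 sqr_ge0.
Qed.

Lemma dotv_ge0 (u : 'rV[R]_n) : 0 <= dotv u u.
Proof. by apply: sumr_ge0 => j _; rewrite -expr2 sqr_ge0. Qed.

Lemma dotv_le_norm (u : 'rV[R]_n) : dotv u u <= n%:R * `|u| ^+ 2.
Proof.
apply: (@le_trans _ _ (\sum_(i < n) `|u| ^+ 2)); last first.
  by rewrite sumr_const card_ord mulr_natl.
apply: ler_sum => i _; rewrite -expr2 -(real_normK (num_real (u ord0 i))).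
by rewrite lerXn2r ?nnegrE // norm_coord_le.
Qed.

(** The function g is arbitrary: it may be the gradient of V along the curve,
    or that gradient times a constant and a cutoff. *)
Lemma energy_conserved (w : R -> R) (q g : R -> 'rV[R]_n) :
  (forall t : R, is_derive t 1 w (dotv (g t) (q t))) ->
  (forall t : R, is_derive t 1 q ((- 2 * w t) *: g t)) ->
  forall t, dotv (q t) (q t) + 2 * w t ^+ 2 = dotv (q 0) (q 0) + 2 * w 0 ^+ 2.
Proof.
move=> dw dq t.
apply: (@is_derive_0_is_cst R (fun t => dotv (q t) (q t) + 2 * w t ^+ 2)) => {}t.
have := is_deriveD (is_derive_dotv (dq t) (dq t)) (is_deriveZ 2 (is_deriveX 2 (dw t))).
move=> H; apply: is_derive_eq H _.
rewrite dotvC dotvZl /GRing.scale /=; ring.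
Qed.

End dot.

(** * The rescaled magnetic system and its two-point problem *)

Section shooting.
Variables (R : realType) (n : nat).
Let Z := (R * 'rV[R]_n)%type.
Let S := (Z * Z)%type.
Variable G : Z -> 'rV[R]_n.
Hypothesis lipG : lip_on_balls G.

(** A state y = (z, v) consists of z = (tau, x) and v = (w, q), where q = eps p
    and w = eps u are the momenta in the rescaled time; G stands for the spatial
    gradient of V.  The system is z' = velocity v, v' = eps force(y). *)
Definition velocity (v : Z) : Z := (2 * v.1, v.2).
Definition force (y : S) : Z := (dotv (G y.1) y.2.2, (- 2 * y.2.1) *: G y.1).

Lemma lip_force : lip_on_balls force.
Proof.
have lG : lip_on_balls (fun y : S => G y.1).
  by apply: (@lip_on_balls_comp _ S Z _ fst) => // a; exact: norm_fst_le.
have lv : lip_on_balls (fun y : S => y.2).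
  apply: (@lip_on_balls_comp _ S Z _ snd id); last exact: lip_on_balls_id.
  by move=> a; exact: norm_snd_le.
have lq : lip_on_balls (fun y : S => y.2.2).
  apply: (@lip_on_balls_comp _ S Z _ snd (fun v => v.2)).
    by move=> a; exact: norm_snd_le.
  apply: (@lip_on_balls_comp _ Z _ _ snd id); last exact: lip_on_balls_id.
  by move=> a; exact: norm_snd_le.
have lw : lip_on_balls (fun y : S => y.2.1).
  apply: (@lip_on_balls_comp _ S Z _ snd (fun v => v.1)).
    by move=> a; exact: norm_snd_le.
  apply: (@lip_on_balls_comp _ Z _ _ fst id); last exact: lip_on_balls_id.
  by move=> a; exact: norm_fst_le.
apply: lip_on_balls_pair.
  apply: lip_on_balls_sum => i.
  by apply: (lip_on_ballsZ (F := R)); exact: lip_on_balls_coord.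
apply: lip_on_ballsZ => //.
by apply: (lip_on_ballsZ (F := R)) => //; exact: lip_on_balls_cst.
Qed.

Lemma velocity_lip (u v : Z) : `|velocity u - velocity v| <= 2 * `|u - v|.
Proof.
rewrite prod_norm_le /= -mulrBr normrM ger0_norm //.
rewrite ler_wpM2l ?(norm_fst_le (u - v)) //=.
apply: le_trans (norm_snd_le (u - v)) _.
by rewrite ler_peMl // ler1n.
Qed.

Lemma norm_velocity_le (v : Z) : `|velocity v| <= 2 * `|v|.
Proof.
have := velocity_lip v 0; rewrite subr0 {2}/velocity /= mulr0.
by rewrite (_ : (0, 0) = 0 :> Z) // subr0.
Qed.

Section cut.
Variables (r0 r1 : R).
Hypotheses (r1_ge0 : 0 <= r1).

Definition cut_field (eps t : R) (y : S) : S :=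
  (velocity y.2, eps *: (cutoff (r0 + r1 * `|t|) y *: force y)).

Lemma cut_field_continuous eps (y : R -> S) :
  continuous y -> continuous (fun t => cut_field eps t (y t)).
Proof.
move=> cy.
have cv : continuous (fun t => velocity (y t).2).
  have lv : lip_on_balls (fun y : S => velocity y.2).
    move=> r; exists 2 => // a b _ _; apply: le_trans (velocity_lip _ _) _.
    by rewrite ler_wpM2l // (norm_snd_le (a - b)).
  move=> t; apply: (@continuous_comp _ _ _ y (fun a : S => velocity a.2)).
    exact: cy.
  exact: lip_on_balls_continuous lv _.
suff cf : continuous (fun t => eps *: (cutoff (r0 + r1 * `|t|) (y t) *: force (y t))).
  by move=> t; exact: (cvg_pair (cv t) (cf t)).
move=> t; apply: cvgZl_tmp; apply: cvgZ.
  apply/cvgrPdist_lt => e e0; pose d := e / 2 / (`|r1| + 1).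
  have d0 : 0 < d by rewrite !divr_gt0 // ltr_pwDr.
  have /cvgrPdist_lt /(_ _ d0) := @norm_continuous _ _ t.
  have e2 : 0 < e / 2 by rewrite divr_gt0.
  have /cvgrPdist_lt /(_ _ e2) := cy t.
  apply: filterS2 => s H1 H2; apply: le_lt_trans (cutoff_lip _ _ _ _) _.
  rewrite opprD addrACA subrr add0r -mulrBr normrM.
  have : `|r1| * `| `|t| - `|s| | <= e / 2.
    move: H2; rewrite /d ltr_pdivlMr ?ltr_pwDr // => /ltW; apply: le_trans.
    by rewrite mulrC ler_wpM2l // lerDl.
  lra.
apply: (@continuous_comp _ _ _ y force); first exact: cy.
exact: lip_on_balls_continuous lip_force _.
Qed.

(** The factor eps in the bounds on the second component is what makes the
    trajectories of [shooting] nearly straight; the Lipschitz constant of the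
    whole field is uniform in eps <= 1. *)
Lemma cut_field_lip : forall T, exists2 C, 0 <= C &
  forall eps t, 0 <= eps <= 1 -> `|t| <= T -> forall a b,
    `|(cut_field eps t a).2| <= eps * C /\
    `|(cut_field eps t a).2 - (cut_field eps t b).2| <= eps * C * `|a - b| /\
    `|cut_field eps t a - cut_field eps t b| <= (2 + C) * `|a - b|.
Proof.
move=> T; have [C C0 HC] := cutoff_scale_lip lip_force (r0 + r1 * T).
exists C => // eps t /andP[e0 e1] tT a b.
have rT : r0 + r1 * `|t| <= r0 + r1 * T by rewrite lerD2l ler_wpM2l.
have [H1 H2] := HC _ rT a b.
have lip2 : `|(cut_field eps t a).2 - (cut_field eps t b).2| <= eps * C * `|a - b|.
  by rewrite /= -scalerBr normrZ ger0_norm // -mulrA ler_wpM2l.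
split; last split => //.
  by rewrite normrZ ger0_norm // ler_wpM2l.
rewrite prod_norm_le; apply/andP; split => /=.
  apply: le_trans (velocity_lip _ _) _.
  by rewrite ler_pM ?lerDl // (norm_snd_le (a - b)).
apply: le_trans lip2 _; rewrite ler_wpM2r //.
apply: (@le_trans _ _ C); last by rewrite lerDr.
by rewrite ler_piMl.
Qed.

Lemma state_has_primitives : has_primitives S.
Proof.
have pR := @has_primitives_real R.
by do !apply: has_primitives_prod => //; exact: has_primitives_rV.
Qed.

Lemma state_mean_value : mean_value_ineq S.
Proof.
have mR := @mean_value_ineq_real R.
by do !apply: mean_value_ineq_prod => //; exact: mean_value_ineq_rV.
Qed.

Lemma cut_solution eps (a : S) : 0 <= eps <= 1 -> exists y : R -> S,
  y 0 = a /\ forall t : R, is_derive t 1 y (cut_field eps t (y t)).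
Proof.
move=> e01.
apply: (picard state_has_primitives state_mean_value (F := cut_field eps)).
  exact: cut_field_continuous.
move=> T; have [C C0 HC] := cut_field_lip T.
exists (2 + C) => [|t u v tT]; first by rewrite ltr_pwDl.
by have [_ []] := HC eps t e01 tT u v.
Qed.

(** By conservation of energy the velocity never exceeds K; the position then
    drifts at speed at most 2 K, the factor 2 coming from tau' = 2 w. *)
Lemma cut_solution_bound eps K (y : R -> S) :
  (forall t : R, is_derive t 1 y (cut_field eps t (y t))) ->
  (y 0).2.1 = 0 -> 0 <= K -> dotv (y 0).2.2 (y 0).2.2 <= K ^+ 2 ->
  forall t, `|y t| <= `|(y 0).1| + K + 2 * K * `|t|.
Proof.
move=> dy w0 K0 qK.
have dz (t : R) := is_derive_fst (dy t).
have dv (t : R) := is_derive_snd (dy t).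
have vK t : `|(y t).2| <= K.
  pose g t := (eps * cutoff (r0 + r1 * `|t|) (y t)) *: G (y t).1.
  have dw (s : R) : is_derive s 1 (fun s => (y s).2.1) (dotv (g s) (y s).2.2).
    apply: is_derive_eq (is_derive_fst (dv s)) _.
    by rewrite /= dotvZl -mulrA.
  have dq (s : R) : is_derive s 1 (fun s => (y s).2.2) ((- 2 * (y s).2.1) *: g s).
    apply: is_derive_eq (is_derive_snd (dv s)) _.
    by rewrite /= !scalerA; congr (_ *: _); ring.
  have := energy_conserved dw dq t; rewrite w0 expr0n mulr0 addr0 => En.
  have := dotv_ge0 (y t).2.2; have := sqr_ge0 (y t).2.1 => w2 q2.
  rewrite prod_norm_le; apply/andP; split.
    rewrite -(ler_sqr (x := `|_|)) ?nnegrE // real_normK ?num_real //; lra.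
  apply/rV_norm_leP => // i.
  rewrite -(ler_sqr (x := `|_|)) ?nnegrE // real_normK ?num_real //.
  have := sqr_coord_le_dotv (y t).2.2 i; lra.
have zK t : `|(y t).1 - (y 0).1| <= 2 * K * `|t|.
  have mv := mean_value_ineq_prod (@mean_value_ineq_real R) (@mean_value_ineq_rV R n).
  have dK (s : R) : is_derive s 1 (fun s : R => 2 * K * s) (2 * K).
    exact: is_derive_eq (is_deriveZ _ (is_derive_id s (1 : R))) (mulr1 _).
  have bnd s : `|velocity (y s).2| <= 2 * K.
    by apply: le_trans (norm_velocity_le _) _; rewrite ler_wpM2l.
  have [t0|/ltW t0] := leP 0 t.
    have := mv _ _ _ _ dz dK 0 t t0; rewrite mulr0 subr0 (ger0_norm t0).
    by apply => s _; exact: bnd.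
  have := mv _ _ _ _ dz dK t 0 t0.
  rewrite mulr0 sub0r distrC (ler0_norm t0) mulrN.
  by apply => s _; exact: bnd.
move=> t; rewrite prod_norm_le; apply/andP; split; last first.
  apply: le_trans (vK t) _; rewrite addrAC lerDr addr_ge0 //.
  by rewrite mulr_ge0 // mulr_ge0.
rewrite -(subrK (y 0).1 (y t).1); apply: le_trans (ler_normD _ _) _.
rewrite addrC -addrA lerD2l; apply: le_trans (zK t) _.
by rewrite lerDr.
Qed.

End cut.
End shooting.

Section two_point.
Variables (R : realType) (n : nat).
Let Z := (R * 'rV[R]_n)%type.
Let S := (Z * Z)%type.

Lemma half_contraction_fixpoint (E : completeNormedModType R) (f : E -> E) :
  (forall a b, `|f a - f b| <= 2^-1 * `|a - b|) -> exists p, p = f p.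
Proof.
move=> Hf; have [|||p _ pE] := @banach_fixed_point R E setT (totalfun f).
- exists (2^-1)%:nng; split; first by rewrite /= invf_lt1 ?ltr1n.
  by move=> [a b] _; exact: Hf.
- exact: closedT.
- by exists 0.
by exists p.
Qed.

(** Two applications of the mean value inequality. *)
Lemma near_straight (E : normedModType R) (x p f : R -> E) (M : R) :
  mean_value_ineq E ->
  (forall t : R, is_derive t 1 x (p t)) -> (forall t : R, is_derive t 1 p (f t)) ->
  (forall t, 0 <= t <= 1 -> `|f t| <= M) -> `|x 1 - x 0 - p 0| <= M.
Proof.
move=> mE dx dp fM.
have M0 : 0 <= M by apply: le_trans (fM 0 _); rewrite ?lexx ?ler01.
have dM (s : R) : is_derive s 1 (fun s : R => M * s) M.
  exact: is_derive_eq (is_deriveZ _ (is_derive_id s (1 : R))) (mulr1 _).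
have pM t : 0 <= t <= 1 -> `|p t - p 0| <= M.
  move=> /andP[t0 t1]; apply: (@le_trans _ _ (M * t)); last by rewrite ler_piMr.
  have := mE _ _ _ _ dp dM 0 t t0; rewrite mulr0 subr0; apply.
  by move=> s /andP[s0 st]; apply: fM; rewrite s0 (le_trans st).
have dl (s : R) : is_derive s 1 ( *:%R ^~ (p 0)) (p 0).
  have dZ := is_diff_scalel s (p 0); apply: DeriveDef.
    by apply/derivable1_diffP.
  by rewrite deriveE // diff_val /= scale1r.
have := mE _ _ _ _ (fun s => is_deriveB (dx s) (dl s)) dM 0 1 ler01.
rewrite !fctE scale1r scale0r subr0 mulr0 mulr1 subr0 addrAC; apply.
by move=> s /pM.
Qed.

(** The errors E(q) = x_q(1) - x0 - q are bounded by eps C and Lipschitz with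
    constant eps D.  The choice of eps makes the first at most 1, so that the
    fixed point satisfies |q| <= B, and the second at most 1 / 2.  The radius
    r0 + r1 |t| of the cutoff is the a priori bound for such velocities; it is
    fixed before eps. *)
Lemma shooting (G : Z -> 'rV[R]_n) (x0 x1 : 'rV[R]_n) : lip_on_balls G ->
  exists (eps : R) (z v : R -> Z),
    [/\ 0 < eps, z 0 = (0, x0), (v 0).1 = 0, (z 1).2 = x1 &
      forall t : R, is_derive t 1 z (velocity (v t)) /\
                    is_derive t 1 v (eps *: force G (z t, v t))].
Proof.
move=> lipG.
(* K^2 bounds q.q when |q| <= B, since the norm is the maximum norm. *)
pose B := `|x1 - x0| + 1; pose K := n.+1%:R * B.
have B0 : 0 <= B by rewrite addr_ge0.
have K0 : 0 <= K by rewrite mulr_ge0.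
pose r0 := `|x0| + K; pose r1 := 2 * K.
have r1_ge0 : 0 <= r1 by rewrite mulr_ge0.
have [C C0 HC] := cut_field_lip lipG r0 r1_ge0 1.
pose D := 2 * expR (2 * (2 + C)) * C.
have D0 : 0 <= D by rewrite !mulr_ge0 // expR_ge0.
pose eps := (1 + C + 2 * D)^-1.
have den : 0 < 1 + C + 2 * D by lra.
have eps0 : 0 < eps by rewrite invr_gt0.
have eps1 : eps * (1 + C + 2 * D) = 1 by rewrite mulVf // gt_eqF.
have epsC : 0 <= eps * C by rewrite mulr_ge0 // ltW.
have epsD : 0 <= eps * D by rewrite mulr_ge0 // ltW.
have eps01 : 0 <= eps <= 1 by rewrite ltW //=; lra.
have /choice[Y HY] : forall q : 'rV[R]_n, exists y : R -> S,
    y 0 = ((0, x0), (0, q)) /\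
    forall t : R, is_derive t 1 y (cut_field G r0 r1 eps t (y t)).
  by move=> q; exact: cut_solution.
have dY q := (HY q).2.
have Y0 q : Y q 0 = ((0, x0), (0, q)) := (HY q).1.
have sepY q q' t : 0 <= t <= 1 ->
    `|Y q t - Y q' t| <= 2 * expR (2 * (2 + C)) * `|q - q'|.
  move=> /andP[t0 t1].
  have lip s a b : `|s| <= 1 ->
      `|cut_field G r0 r1 eps s a - cut_field G r0 r1 eps s b| <= (2 + C) * `|a - b|.
    by move=> s1; have [_ []] := HC eps s eps01 s1 a b.
  have L0 : 0 < 2 + C by lra.
  have t1' : `|t| <= 1 by rewrite ger0_norm.
  have := gronwall (@state_mean_value R n) L0 (dY q) (dY q') lip t1'.
  move=> /le_trans; apply; rewrite mulrAC ler_pM ?mulr_ge0 ?expR_ge0 //.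
    rewrite ler_wpM2l // ler_expR ger0_norm // ler_piMr //.
    by rewrite mulr_ge0 // ltW.
  by rewrite !Y0 !prod_norm_le /= !subrr !normr0 normr_ge0 lexx.
pose X q t := (Y q t).1.2; pose Q q t := (Y q t).2.2.
pose A q t := (cut_field G r0 r1 eps t (Y q t)).2.2.
have dX q (t : R) : is_derive t 1 (X q) (Q q t).
  exact: is_derive_snd (is_derive_fst (dY q t)).
have dQ q (t : R) : is_derive t 1 (Q q) (A q t).
  exact: is_derive_snd (is_derive_snd (dY q t)).
pose E q := X q 1 - x0 - q.
have E_small q : `|E q| <= eps * C.
  have := near_straight (@mean_value_ineq_rV R n) (dX q) (dQ q).
  rewrite /X /Q !Y0; apply => t /andP[t0 t1].
  have t1' : `|t| <= 1 by rewrite ger0_norm.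
  have [H _] := HC eps t eps01 t1' (Y q t) (Y q t).
  by apply: le_trans H; exact: norm_snd_le.
have E_lip q q' : `|E q - E q'| <= eps * D * `|q - q'|.
  have := near_straight (@mean_value_ineq_rV R n)
    (fun t => is_deriveB (dX q t) (dX q' t)) (fun t => is_deriveB (dQ q t) (dQ q' t)).
  rewrite !fctE /E /X /Q !Y0 /= subrr subr0.
  have -> : (Y q 1).1.2 - (Y q' 1).1.2 - (q - q') =
     (Y q 1).1.2 - x0 - q - ((Y q' 1).1.2 - x0 - q').
    by apply/matrixP => i j; rewrite !mxE; ring.
  apply => t t01.
  have t1' : `|t| <= 1 by move: t01 => /andP[t0 t1]; rewrite ger0_norm.
  have [_ [H _]] := HC eps t eps01 t1' (Y q t) (Y q' t).
  have {H} : `|A q t - A q' t| <= eps * C * `|Y q t - Y q' t|.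
    by apply: le_trans H; exact: (norm_snd_le (_ - _)).
  move=> /le_trans; apply; rewrite /D.
  have -> : eps * (2 * expR (2 * (2 + C)) * C) * `|q - q'| =
    eps * C * (2 * expR (2 * (2 + C)) * `|q - q'|) by ring.
  by rewrite ler_wpM2l // sepY.
(* The fixed point is the initial velocity whose trajectory ends at x1. *)
have [q qE] : exists q, q = x1 - x0 - E q.
  apply: (@half_contraction_fixpoint 'rV[R]_n) => q q'.
  have -> : x1 - x0 - E q - (x1 - x0 - E q') = - (E q - E q').
    by apply/matrixP => i j; rewrite !mxE; ring.
  rewrite normrN; apply: le_trans (E_lip _ _) _; rewrite ler_wpM2r //.
  lra.
have X1 : X q 1 = x1.
  have /matrixP := qE => H; apply/matrixP => i j; have := H i j.
  by rewrite /E !mxE; lra.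
have qB : `|q| <= B.
  rewrite qE; apply: le_trans (ler_normB _ _) _; rewrite lerD2l.
  by apply: le_trans (E_small q) _; lra.
have qK : dotv q q <= K ^+ 2.
  apply: le_trans (dotv_le_norm q) _; rewrite /K exprMn.
  have nn : n%:R <= n.+1%:R ^+ 2 :> R.
    by rewrite -natrX ler_nat -mulnn (leq_trans (leqnSn n)) // leq_pmulr.
  by rewrite ler_pM ?exprn_ge0 // lerXn2r ?nnegrE.
have bound t : `|Y q t| <= r0 + r1 * `|t|.
  have := cut_solution_bound (K := K) (dY q); rewrite !Y0 => /(_ erefl K0 qK t).
  by move=> /le_trans; apply; rewrite /r0 !lerD2r prod_norm_le /= normr0 normr_ge0 lexx.
exists eps, (fun t => (Y q t).1), (fun t => (Y q t).2).
split => //; rewrite ?Y0 // => t; split; first exact: is_derive_fst (dY q t).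
apply: is_derive_eq (is_derive_snd (dY q t)) _.
by rewrite /= cutoff_eq1 // scale1r -surjective_pairing.
Qed.

End two_point.

(** * Back to the second-order equation *)

Section trajectory.
Variable R : realType.

Lemma is_derive_rescale (E : normedModType R) (f : R -> E) (k t : R) (d : E) :
  is_derive (k * t) 1 f d -> is_derive t 1 (fun s => f (k * s)) (k *: d).
Proof.
move=> [df <-]; have df' := (derivable1_diffP f (k * t)).1 df.
have dk : is_derive t 1 (fun s : R => k * s) k.
  exact: is_derive_eq (is_deriveZ k (is_derive_id t (1 : R))) (mulr1 k).
apply: is_derive_eq (is_derive_along (g := fun s => k * s) df' dk) _.
by rewrite (deriveE k df') diff1E // derive1E.
Qed.

Lemma derive1_val (E : normedModType R) (f f' : R -> E) :
  (forall t : R, is_derive t 1 f (f' t)) -> derive1 f = f'.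
Proof. by move=> df; apply/funext => t; rewrite derive1E; case: (df t). Qed.

Lemma derive_dir (E : normedModType R) (f f' : R -> E) (v : R) :
  (forall t : R, is_derive t 1 f (f' t)) -> 'D_v f = (fun t => v *: f' t).
Proof.
move=> df; apply/funext => t; have [dft <-] := df t.
have dft' := (derivable1_diffP f t).1 dft.
by rewrite (deriveE v dft') diff1E // derive1E.
Qed.

Lemma classC2_of_derivatives (E : normedModType R) (f f' f'' : R -> E) :
  (forall t : R, is_derive t 1 f (f' t)) ->
  (forall t : R, is_derive t 1 f' (f'' t)) -> continuous f'' -> classC 2 f.
Proof.
move=> df df' cf''; split=> [t|v].
  by apply/derivable1_diffP; case: (df t).
rewrite (derive_dir v df).
have dvf (t : R) : is_derive t 1 (fun t => v *: f' t) (v *: f'' t).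
  exact: is_deriveZ.
split=> [t|u]; first by apply/derivable1_diffP; case: (dvf t).
rewrite (derive_dir u dvf) => t; apply: cvgZl_tmp; apply: cvgZl_tmp.
exact: cf''.
Qed.

Lemma classC2_derive1 (E : normedModType R) (f : R -> E) : classC 2 f ->
  (forall t : R, is_derive t 1 f (derive1 f t)) /\ continuous (derive1 f).
Proof.
move=> [df cf]; split=> [t|].
  by apply: DeriveDef; [exact/derivable1_diffP|rewrite derive1E].
have -> : derive1 f = 'D_1 f by apply/funext => t; rewrite derive1E.
have [d1f _] := cf 1 => t; exact: differentiable_continuous.
Qed.

Lemma oriented_int_primitive (a b : R) (f F : R -> R) :
  (forall t : R, is_derive t 1 F (f t)) -> continuous f ->
  oriented_int a b f = F b - F a.
Proof.
move=> dF cf; have cF := is_derive_continuous dF.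
have FTC (c d : R) : c < d ->
    \int[lebesgue_measure]_(s in `[c, d]) f s = F d - F c.
  move=> cd; rewrite /Rintegral (@continuous_FTC2 R f F c d) //.
  - exact: continuous_subspaceT.
  - split=> [x _||]; first by case: (dF x).
      by apply: cvg_at_right_filter; exact: cF.
    by apply: cvg_at_left_filter; exact: cF.
  - by move=> x _; rewrite (derive1_val dF).
rewrite /oriented_int; case: ltgtP => [ab|ab|->].
- exact: FTC.
- by rewrite FTC // opprB.
- by rewrite set_itv1 Rintegral_set1 subrr.
Qed.

Variable n : nat.

Lemma continuous_dotv (f g : R -> 'rV[R]_n) :
  continuous f -> continuous g -> continuous (fun t => dotv (f t) (g t)).
Proof.
move=> cf cg t.
have -> : (fun s => dotv (f s) (g s)) =
    \sum_i ((fun s => f s ord0 i) * (fun s => g s ord0 i)).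
  by apply/funext => s; rewrite fct_sumE.
have cc (h : R -> 'rV[R]_n) i : continuous h -> continuous (fun s => h s ord0 i).
  move=> ch s; apply: (@continuous_comp _ _ _ h (fun v : 'rV[R]_n => v ord0 i)).
    exact: ch.
  exact: coord_continuous.
elim/big_ind : _ => [|u v cu cv|i _]; first exact: cvg_cst.
  exact: cvgD.
by apply: cvgM; exact: cc.
Qed.

Let Z := (R * 'rV[R]_n)%type.

(** Undo the scaling: the positions at time t are the rescaled ones at time
    t / eps, so that x1 is reached at time eps, and u = w / eps, p = q / eps. *)
Lemma trajectory_through (G : Z -> 'rV[R]_n) (x0 x1 : 'rV[R]_n) :
  lip_on_balls G -> exists (tau u : R -> R) (x p : R -> 'rV[R]_n),
    [/\ u 0 = 0, x 0 = x0, exists t1, x t1 = x1 &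
      forall t : R,
      [/\ is_derive t 1 x (p t), is_derive t 1 tau (2 * u t),
          is_derive t 1 p ((- 2 * u t) *: G (tau t, x t)) &
          is_derive t 1 u (dotv (G (tau t, x t)) (p t))]].
Proof.
move=> lipG; have [eps [z [v [eps0 z0 v0 z1 dzv]]]] := shooting x0 x1 lipG.
pose k := eps^-1; have kE : k * eps = 1 by rewrite mulVf ?gt_eqF.
have dz t := (dzv (k * t)).1; have dv t := (dzv (k * t)).2.
exists (fun t => (z (k * t)).1), (fun t => k * (v (k * t)).1).
exists (fun t => (z (k * t)).2), (fun t => k *: (v (k * t)).2).
split; rewrite ?mulr0 ?z0 ?v0 ?mulr0 //.
  by exists eps; rewrite kE.
move=> t; split.
- exact: is_derive_rescale (is_derive_snd (dz t)).
- apply: is_derive_eq (is_derive_rescale (is_derive_fst (dz t))) _.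
  by rewrite /GRing.scale /=; ring.
- apply: is_derive_eq (is_deriveZ k (is_derive_rescale (is_derive_snd (dv t)))) _.
  rewrite /= -surjective_pairing !scalerA; congr (_ *: _).
  transitivity (k * eps * (- 2 * (k * (v (k * t)).1))); first by ring.
  by rewrite kE mul1r.
- apply: is_derive_eq (is_deriveZ k (is_derive_rescale (is_derive_fst (dv t)))) _.
  rewrite /= -surjective_pairing (dotvC _ (k *: _)) dotvZl dotvC /GRing.scale /=.
  by rewrite (mulrA k eps) kE mul1r.
Qed.

Section potential.
Variable V : Z -> R.
Hypothesis hV : classC 2 V.

Definition spatial_grad (z : Z) : 'rV[R]_n := \row_i 'D_(0, delta_mx ord0 i) V z.

Lemma spatial_grad_lip : lip_on_balls spatial_grad.
Proof.
apply: lip_on_balls_row => i.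
have -> : (fun z => spatial_grad z ord0 i) = 'D_(0, delta_mx ord0 i) V.
  by apply/funext => z; rewrite mxE.
have [_ dV] := hV; exact: C1_lip_on_balls (dV (0, delta_mx ord0 i)).
Qed.

Lemma derive_slice (s : R) (x d : 'rV[R]_n) :
  'D_d (fun y => V (s, y)) x = 'D_(0, d) V (s, x).
Proof.
rewrite /derive; set f := (f in lim (f @ _)); set g := (g in _ = lim (g @ _)).
suff -> : f = g by [].
apply/funext => h; rewrite /f /g /=; congr (_ *: (V _ - _)).
by apply: injective_projections; rewrite /= ?scaler0 ?add0r.
Qed.

Lemma grad_slice (s : R) (x : 'rV[R]_n) :
  grad (fun y => V (s, y)) x = spatial_grad (s, x).
Proof. by apply/rowP => i; rewrite !mxE derive_slice. Qed.

Lemma grad_reparam (tau : R -> R) (t : R) (x : 'rV[R]_n) :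
  grad (reparam V tau t) x = spatial_grad (tau t, x).
Proof. exact: grad_slice. Qed.

Lemma differentiable_slice (s : R) (x : 'rV[R]_n) :
  differentiable (fun y => V (s, y)) x.
Proof.
apply: (@differentiable_comp _ _ _ _ (fun y => (s, y)) V); last exact: hV.1.
exact: differentiable_pair.
Qed.

Lemma is_derive_slice_along (s : R) (y : R -> 'rV[R]_n) (t : R) (d : 'rV[R]_n) :
  is_derive t 1 y d ->
  is_derive t 1 (fun r => V (s, y r)) (dotv (spatial_grad (s, y t)) d).
Proof.
move=> dy.
apply: is_derive_eq (is_derive_along (differentiable_slice s (y t)) dy) _.
have [dV _] := hV; rewrite derive_slice (derive_coordinates (0, d) (dV _)) /=.
rewrite mul0r add0r.
by apply: eq_bigr => i _; rewrite mxE mulrC.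
Qed.

Lemma constant_in_time (t : R) (y : 'rV[R]_n) :
  (forall (t : R) (y : 'rV[R]_n), derive1 (fun s : R => V (s, y)) t = 0) ->
  V (t, y) = V (0, y).
Proof.
move=> Vt0; apply: (@is_derive_0_is_cst R (fun s => V (s, y))) => s.
have ds : differentiable (fun s : R => V (s, y)) s.
  apply: (@differentiable_comp _ _ _ _ (fun s => (s, y)) V); last exact: hV.1.
  exact: differentiable_pair.
apply: DeriveDef; first exact/derivable1_diffP.
by rewrite -derive1E Vt0.
Qed.

(** In the autonomous case this turns the force - 2 (V + cbar) grad V into minus
    the gradient of the potential (V + cbar)^2. *)
Lemma grad_square (s c : R) (x : 'rV[R]_n) :
  grad (fun y => (V (s, y) + c) ^+ 2) x = (2 * (V (s, x) + c)) *: spatial_grad (s, x).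
Proof.
apply/rowP => i; rewrite !mxE -derive_slice.
have dV : derivable (fun y => V (s, y)) x (delta_mx ord0 i).
  exact/diff_derivable/differentiable_slice.
have := is_deriveX 2 (is_deriveD (derivableP dV) (is_derive_cst c x (delta_mx ord0 i))).
by move=> [_]; rewrite addr0 expr1.
Qed.

End potential.
End trajectory.

Lemma enorm_sqr (R : realType) n (u : 'rV[R]_n) : enorm u ^+ 2 = dotv u u.
Proof. by rewrite sqr_sqrtr // dotv_ge0. Qed.

Theorem theorem6 (R : realType) (n : nat) (V : R * 'rV[R]_n -> R)
    (hV : classC 2 V) (x0 x1 : 'rV[R]_n) :
  exists (c : R) (tau : R -> R),
    classC 2 tau /\
    exists (x : R -> 'rV[R]_n) (E : R),
      [/\ classC 2 x,
          x 0 = x0 /\ (exists t1 : R, x t1 = x1),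
          solves_ode (reparam V tau) c x,
          (forall t : R,
             2^-1 * enorm (derive1 x t) ^+ 2 + 4^-1 * derive1 tau t ^+ 2 = E)
        & (forall (t : R) (y : 'rV[R]_n), derive1 (fun s : R => V (s, y)) t = 0) ->
          exists W : 'rV[R]_n -> R,
            (forall (t : R) (y : 'rV[R]_n), V (t, y) = W y) /\
            let cbar := c - W x0 in
            [/\ (forall y : R -> 'rV[R]_n, classC 2 y -> y 0 = x0 ->
                   (solves_ode (reparam V tau) c y <->
                    solves_hamiltonian (fun z => (W z + cbar) ^+ 2) y)),
                solves_hamiltonian (fun z => (W z + cbar) ^+ 2) x
              & (forall t : R,
                   2^-1 * enorm (derive1 x t) ^+ 2 + (W (x t) + cbar) ^+ 2 = E)]].
Proof.
have lipG := spatial_grad_lip hV; pose G := spatial_grad V.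
have [tau [u [x [p [u0 x00 xt1 dyn]]]]] := trajectory_through x0 x1 lipG.
have dx (t : R) : is_derive t 1 x (p t) by case: (dyn t).
have dtau (t : R) : is_derive t 1 tau (2 * u t) by case: (dyn t).
have dp (t : R) : is_derive t 1 p ((- 2 * u t) *: G (tau t, x t)) by case: (dyn t).
have du (t : R) : is_derive t 1 u (dotv (G (tau t, x t)) (p t)) by case: (dyn t).
have cGalong (s : R -> R) (y : R -> 'rV[R]_n) :
    continuous s -> continuous y -> continuous (fun t => G (s t, y t)).
  move=> cs cy t; apply: (@continuous_comp _ _ _ (fun t => (s t, y t)) G).
    exact: (cvg_pair (cs t) (cy t)).
  exact: lip_on_balls_continuous lipG _.
have cG := cGalong _ _ (is_derive_continuous dtau) (is_derive_continuous dx).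
have cforce := continuous_dotv cG (is_derive_continuous dp).
have x'E := derive1_val dx.
have Cx : classC 2 x.
  apply: classC2_of_derivatives dx dp _ => t; apply: cvgZ; last exact: cG.
  apply: cvgM; first exact: cvg_cst.
  exact: (is_derive_continuous du).
(* As u(0) = 0 = c, the function u is c plus the work of the force. *)
have work_x t :
    oriented_int 0 t (fun s => dotv (grad (reparam V tau s) (x s)) (p s)) = u t.
  have -> : (fun s => dotv (grad (reparam V tau s) (x s)) (p s)) =
      (fun s => dotv (G (tau s, x s)) (p s)).
    by apply/funext => s; rewrite grad_reparam.
  by rewrite (oriented_int_primitive 0 t du cforce) u0 subr0.
have ode : solves_ode (reparam V tau) 0 x.
  move=> t; rewrite /derive1n /= x'E (derive1_val dp) work_x add0r.
  by rewrite grad_reparam.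
have energy t : dotv (p t) (p t) + 2 * u t ^+ 2 = dotv (p 0) (p 0).
  by have := energy_conserved du dp t; rewrite u0 expr0n mulr0 addr0.
exists 0, tau; split.
  apply: classC2_of_derivatives dtau (fun t => is_deriveZ 2 (du t)) _ => t.
  by apply: cvgZl_tmp; exact: cforce.
exists x, (2^-1 * dotv (p 0) (p 0)); split=> //.
  by move=> t; rewrite x'E (derive1_val dtau) enorm_sqr -(energy t); field.
move=> Vt0; pose W y := V (0, y).
have VW t y : V (t, y) = W y by exact: constant_in_time.
have GW t y : G (t, y) = G (0, y).
  rewrite /G -!grad_slice; congr (grad _ y); apply/funext => z; exact: VW.
exists W; split=> //= ; set cbar := 0 - W x0.
(* Without dependence on time the work depends on the endpoints only. *)
have work (y : R -> 'rV[R]_n) t : classC 2 y -> y 0 = x0 ->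
    oriented_int 0 t (fun s => dotv (grad (reparam V tau s) (y s)) (derive1 y s)) =
    W (y t) + cbar.
  move=> /classC2_derive1[dy cy'] y0.
  have -> : (fun s => dotv (grad (reparam V tau s) (y s)) (derive1 y s)) =
      (fun s => dotv (G (0, y s)) (derive1 y s)).
    by apply/funext => s; rewrite grad_reparam -/G GW.
  have dW (s : R) : is_derive s 1 (fun s => W (y s)) (dotv (G (0, y s)) (derive1 y s)).
    exact: is_derive_slice_along.
  have cW : continuous (fun s => dotv (G (0, y s)) (derive1 y s)).
    apply: continuous_dotv; last exact: cy'.
    apply: cGalong; first by move=> s; exact: cvg_cst.
    exact: is_derive_continuous dy.
  by rewrite (oriented_int_primitive 0 t dW cW) y0 /cbar sub0r.
have equiv (y : R -> 'rV[R]_n) : classC 2 y -> y 0 = x0 ->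
    (solves_ode (reparam V tau) 0 y <->
     solves_hamiltonian (fun z => (W z + cbar) ^+ 2) y).
  move=> Cy y0; rewrite /solves_ode /solves_hamiltonian.
  have rhs t : (- 2 * (0 + (W (y t) + cbar))) *: grad (reparam V tau t) (y t) =
      - grad (fun z => (W z + cbar) ^+ 2) (y t).
    by rewrite grad_square // grad_reparam -/G GW add0r mulNr scaleNr.
  by split=> H t; rewrite H work // rhs.
split=> //; first exact/equiv.
move=> t; rewrite x'E enorm_sqr -(energy t).
suff -> : u t = W (x t) + cbar by field.
by rewrite -(work x t Cx x00) x'E work_x.
Qed.
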